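(* $E^{ce}_{\mathrm{set}}\not\leq_cE^{ce}_3$.
   Context: $W_e$ is the $e$-th c.e. set; $A^{[n]}=\{x:\langle x,n\rangle\in A\}$ is the $n$-th column of $A\subseteq\omega$. $i\,E^{ce}_{\mathrm{set}}\,j\iff\{W_i^{[n]}:n\in\omega\}=\{W_j^{[n]}:n\in\omega\}$. $i\,E^{ce}_3\,j\iff$ for every $n$, $W_i^{[n]}\triangle W_j^{[n]}$ is finite. $E\leq_cF$ means there is a total computable $g$ with $x\,E\,y\iff g(x)\,F\,g(y)$ for all $x,y$. *)

(* Defs.v *)
From Stdlib Require Import Arith List Cantor.

Definition pair (x y : nat) : nat := Cantor.to_nat (x, y).
Definition unpair (n : nat) : nat * nat := Cantor.of_nat n.

(* Programs for unary partial recursive functions (multiple arguments are coded by pairing). *)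
Inductive code : Type :=
| CZero
| CSucc
| CFst
| CSnd
| CComp (f g : code)
| CPair (f g : code)
| CRec (f g : code)
| CMu (f : code).

Inductive eval : code -> nat -> nat -> Prop :=
| ev_zero x : eval CZero x 0
| ev_succ x : eval CSucc x (S x)
| ev_fst a b : eval CFst (pair a b) a
| ev_snd a b : eval CSnd (pair a b) b
| ev_comp f g x y z : eval g x y -> eval f y z -> eval (CComp f g) x z
| ev_pair f g x y z : eval f x y -> eval g x z -> eval (CPair f g) x (pair y z)
| ev_rec0 f g x y : eval f x y -> eval (CRec f g) (pair x 0) y
| ev_recS f g x n r y :
    eval (CRec f g) (pair x n) r -> eval g (pair x (pair n r)) y ->
    eval (CRec f g) (pair x (S n)) y
| ev_mu f x n :
    eval f (pair x n) 0 ->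
    (forall m, m < n -> exists k, k <> 0 /\ eval f (pair x m) k) ->
    eval (CMu f) x n.

(* Goedel numbering: a computable surjection nat -> code (decoding by residue mod 8
   and Cantor unpairing of the quotient). *)
Fixpoint dec (fuel n : nat) : code :=
  match fuel with
  | 0 => CZero
  | S fu =>
    let m := n / 8 in
    let a := fst (unpair m) in
    let b := snd (unpair m) in
    match n mod 8 with
    | 0 => CZero
    | 1 => CSucc
    | 2 => CFst
    | 3 => CSnd
    | 4 => CComp (dec fu a) (dec fu b)
    | 5 => CPair (dec fu a) (dec fu b)
    | 6 => CRec (dec fu a) (dec fu b)
    | _ => CMu (dec fu m)
    end
  end.

Definition program (e : nat) : code := dec (S e) e.

Definition halts (e x : nat) : Prop := exists y, eval (program e) x y.

Definition W (e : nat) : nat -> Prop := fun x => halts e x.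

Definition column (A : nat -> Prop) (n : nat) : nat -> Prop := fun x => A (pair x n).

Definition set_eq (A B : nat -> Prop) : Prop := forall x, A x <-> B x.

Definition finite_set (A : nat -> Prop) : Prop := exists l : list nat, forall x, A x -> In x l.

Definition symdiff (A B : nat -> Prop) : nat -> Prop :=
  fun x => (A x /\ ~ B x) \/ (B x /\ ~ A x).

Definition Ece_set (i j : nat) : Prop :=
  (forall n, exists m, set_eq (column (W i) n) (column (W j) m)) /\
  (forall m, exists n, set_eq (column (W i) n) (column (W j) m)).

Definition Ece_3 (i j : nat) : Prop :=
  forall n, finite_set (symdiff (column (W i) n) (column (W j) n)).

Definition computable (g : nat -> nat) : Prop :=
  exists e, forall x, eval (program e) x (g x).

Definition creducible (E F : nat -> nat -> Prop) : Prop :=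
  exists g, computable g /\ forall x y, E x y <-> F (g x) (g y).

(* Main.v *)
Require Import Defs.
From Stdlib Require Import Arith List Cantor Lia Classical.

(** [Ece_3] is an intersection of the relations [F_n], "the [n]-th columns differ
    finitely", and each of these is a Sigma_3 equivalence relation.  If [g] were a
    reduction, each pullback [F_n^g] would be a Sigma_3 equivalence relation containing
    [Ece_set].  Let [a] present the family of the finite initial segments of omega, and
    let [b] present the same family together with omega itself.  The recursion theorem
    provides [j] whose columns are all finite initial segments, plus for every [k] a
    column which is omega if the [n]-th columns of [g a] and [g j] agree from [k] on, and
    a finite initial segment otherwise.  If [a F_n^g j] failed, [j] would present the same
    family as [a], so [a F_n^g j] holds.  But then [j] presents the same family as [b],
    whence [a F_n^g j F_n^g b].  As [n] is arbitrary, [g a] and [g b] are [Ece_3]-equivalent,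
    although [a] and [b] present different families. *)

(** * Total computable functions *)

Definition pi1 (n : nat) : nat := fst (unpair n).
Definition pi2 (n : nat) : nat := snd (unpair n).

Lemma pi1_pair a b : pi1 (pair a b) = a.
Proof. unfold pi1, pair, unpair. now rewrite cancel_of_to. Qed.

Lemma pi2_pair a b : pi2 (pair a b) = b.
Proof. unfold pi2, pair, unpair. now rewrite cancel_of_to. Qed.

Lemma pair_pi z : pair (pi1 z) (pi2 z) = z.
Proof.
  unfold pi1, pi2, pair, unpair. rewrite <- surjective_pairing. apply cancel_to_of.
Qed.

Lemma pi_le z : pi1 z <= z /\ pi2 z <= z.
Proof.
  pose proof (to_nat_non_decreasing (pi1 z) (pi2 z)) as H.
  change (to_nat (pi1 z, pi2 z)) with (pair (pi1 z) (pi2 z)) in H.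
  rewrite pair_pi in H. lia.
Qed.

Ltac simpl_pi := repeat first [rewrite pi1_pair | rewrite pi2_pair].

Definition total_comp (f : nat -> nat) : Prop := exists c, forall x, eval c x (f x).

Lemma comp_ext f h : (forall x, f x = h x) -> total_comp f -> total_comp h.
Proof. intros E [c H]. exists c. intro x. rewrite <- E. apply H. Qed.

Lemma eval_fst z : eval CFst z (pi1 z).
Proof. rewrite <- (pair_pi z) at 1. constructor. Qed.

Lemma eval_snd z : eval CSnd z (pi2 z).
Proof. rewrite <- (pair_pi z) at 1. constructor. Qed.

Lemma comp_pair f h :
  total_comp f -> total_comp h -> total_comp (fun x => pair (f x) (h x)).
Proof. intros [c H] [d K]. exists (CPair c d). intro x. now constructor. Qed.

Lemma comp_comp f h : total_comp f -> total_comp h -> total_comp (fun x => f (h x)).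
Proof. intros [c H] [d K]. exists (CComp c d). intro x. now econstructor. Qed.

Lemma comp_id : total_comp (fun x => x).
Proof.
  exists (CPair CFst CSnd). intro x. rewrite <- (pair_pi x) at 2.
  constructor; [apply eval_fst | apply eval_snd].
Qed.

Lemma comp_pi1 f : total_comp f -> total_comp (fun x => pi1 (f x)).
Proof. apply comp_comp. exists CFst. apply eval_fst. Qed.

Lemma comp_pi2 f : total_comp f -> total_comp (fun x => pi2 (f x)).
Proof. apply comp_comp. exists CSnd. apply eval_snd. Qed.

Lemma comp_S f : total_comp f -> total_comp (fun x => S (f x)).
Proof. apply (comp_comp S). exists CSucc. constructor. Qed.

Fixpoint const_code (n : nat) : code :=
  match n with 0 => CZero | S n => CComp CSucc (const_code n) end.

Lemma eval_const n x : eval (const_code n) x n.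
Proof. induction n; simpl; econstructor; eauto; constructor. Qed.

Lemma comp_const n : total_comp (fun _ => n).
Proof. exists (const_code n). apply eval_const. Qed.

Lemma comp_rec (f h : nat -> nat) (p q : nat -> nat) :
  total_comp f -> total_comp h -> total_comp p -> total_comp q ->
  total_comp (fun z => nat_rect (fun _ => nat) (f (p z))
                         (fun n r => h (pair (p z) (pair n r))) (q z)).
Proof.
  intros [c H] [d K] Hp Hq.
  eapply comp_ext;
    [|apply (comp_comp (fun z => nat_rect (fun _ => nat) (f (pi1 z))
               (fun n r => h (pair (pi1 z) (pair n r))) (pi2 z)));
      [|exact (comp_pair _ _ Hp Hq)]].
  - intro x; simpl. now rewrite pi1_pair, pi2_pair.
  - exists (CRec c d). intro z. rewrite <- (pair_pi z) at 1.
    generalize (pi1 z) (pi2 z). intros x n. induction n; simpl.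
    + now constructor.
    + econstructor; eauto.
Qed.

Definition natcase (n a b : nat) : nat := match n with 0 => a | S _ => b end.

Lemma comp_case f p q :
  total_comp f -> total_comp p -> total_comp q ->
  total_comp (fun x => natcase (f x) (p x) (q x)).
Proof.
  intros Hf Hp Hq.
  eapply comp_ext;
    [|exact (comp_rec _ _ _ _ Hp (comp_comp _ _ Hq (comp_pi1 _ comp_id)) comp_id Hf)].
  intro x; simpl. destruct (f x); simpl; [reflexivity | now rewrite pi1_pair].
Qed.

Lemma comp_pred f : total_comp f -> total_comp (fun x => Nat.pred (f x)).
Proof.
  intros Hf.
  eapply comp_ext;
    [|exact (comp_rec _ _ _ _ (comp_const 0) (comp_pi1 _ (comp_pi2 _ comp_id)) comp_id Hf)].
  intro x; simpl. destruct (f x); simpl; [reflexivity | now rewrite pi2_pair, pi1_pair].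
Qed.

Lemma comp_iter f p q :
  total_comp f -> total_comp p -> total_comp q ->
  total_comp (fun x => Nat.iter (p x) f (q x)).
Proof.
  intros Hf Hp Hq.
  eapply comp_ext;
    [|exact (comp_rec _ _ _ _ comp_id (comp_comp _ _ Hf (comp_pi2 _ (comp_pi2 _ comp_id))) Hq Hp)].
  intro x; simpl. induction (p x); simpl; [reflexivity | now rewrite !pi2_pair, IHn].
Qed.

Lemma comp_add f h : total_comp f -> total_comp h -> total_comp (fun x => f x + h x).
Proof.
  intros Hf Hh.
  eapply comp_ext; [|exact (comp_iter S _ _ (comp_S _ comp_id) Hf Hh)].
  intro x; simpl. induction (f x); simpl; congruence.
Qed.

Lemma comp_sub f h : total_comp f -> total_comp h -> total_comp (fun x => f x - h x).
Proof.
  intros Hf Hh.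
  eapply comp_ext; [|exact (comp_iter Nat.pred _ _ (comp_pred _ comp_id) Hh Hf)].
  intro x; simpl. induction (h x); simpl; [lia | rewrite IHn; lia].
Qed.

(** Counting in base 8 with a carry, which occurs when [7 - pi2 z] vanishes. The universal machine
    decodes programs by dividing by 8, so this division has to be computable. *)
Definition divmod8_step (z : nat) : nat :=
  natcase (7 - pi2 z) (pair (S (pi1 z)) 0) (pair (pi1 z) (S (pi2 z))).

Lemma divmod8_iter n : Nat.iter n divmod8_step (pair 0 0) = pair (n / 8) (n mod 8).
Proof.
  induction n as [|n IH]; [reflexivity|].
  simpl Nat.iter. rewrite IH. unfold divmod8_step. rewrite pi1_pair, pi2_pair.
  pose proof (Nat.div_mod_eq n 8) as E. pose proof (Nat.mod_upper_bound n 8 ltac:(lia)) as B.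
  destruct (7 - n mod 8) eqn:D; cbn [natcase]; f_equal.
  - apply (Nat.div_unique _ _ _ 0); lia.
  - apply (Nat.mod_unique _ _ (S (n / 8))); lia.
  - apply (Nat.div_unique _ _ _ (S (n mod 8))); lia.
  - apply (Nat.mod_unique _ _ (n / 8)); lia.
Qed.

Ltac comp_step :=
  lazymatch goal with
  | |- total_comp (fun x => x) => apply comp_id
  | |- total_comp (fun x => pair _ _) => apply comp_pair
  | |- total_comp (fun x => pi1 _) => apply comp_pi1
  | |- total_comp (fun x => pi2 _) => apply comp_pi2
  | |- total_comp (fun x => S _) => apply comp_S
  | |- total_comp (fun x => Nat.pred _) => apply comp_pred
  | |- total_comp (fun x => natcase _ _ _) => apply comp_case
  | |- total_comp (fun x => _ + _) => apply comp_add
  | |- total_comp (fun x => _ - _) => apply comp_sub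
  | |- total_comp pi1 => apply (comp_pi1 _ comp_id)
  | |- total_comp pi2 => apply (comp_pi2 _ comp_id)
  | |- total_comp S => apply (comp_S _ comp_id)
  | |- total_comp _ => apply comp_const
  end.
Ltac comp := repeat comp_step.

Lemma comp_divmod8 f : total_comp f -> total_comp (fun x => pair (f x / 8) (f x mod 8)).
Proof.
  intro Hf.
  eapply comp_ext; [|apply (comp_iter divmod8_step f (fun _ => pair 0 0)); [|exact Hf|comp]].
  - intro x. apply divmod8_iter.
  - unfold divmod8_step. comp.
Qed.

Lemma comp_div8 f : total_comp f -> total_comp (fun x => f x / 8).
Proof.
  intro Hf. eapply comp_ext; [|apply comp_pi1, comp_divmod8, Hf].
  intro x. apply pi1_pair.
Qed.

Lemma comp_mod8 f : total_comp f -> total_comp (fun x => f x mod 8).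
Proof.
  intro Hf. eapply comp_ext; [|apply comp_pi2, comp_divmod8, Hf].
  intro x. apply pi2_pair.
Qed.

(** * Goedel numbering *)

Lemma dec_S fu n :
  dec (S fu) n =
  match n mod 8 with
  | 0 => CZero
  | 1 => CSucc
  | 2 => CFst
  | 3 => CSnd
  | 4 => CComp (dec fu (pi1 (n / 8))) (dec fu (pi2 (n / 8)))
  | 5 => CPair (dec fu (pi1 (n / 8))) (dec fu (pi2 (n / 8)))
  | 6 => CRec (dec fu (pi1 (n / 8))) (dec fu (pi2 (n / 8)))
  | _ => CMu (dec fu (n / 8))
  end.
Proof. reflexivity. Qed.

(** Recursive calls decode numbers at most [n / 8], which is below [n] unless [n = 0], and [0]
    decodes to [CZero] with or without fuel. So fuel above [n] always suffices, and [program] obeys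
    a recursion free of fuel. *)
Lemma dec_fuel f1 : forall f2 n, n < f1 -> n < f2 -> dec f1 n = dec f2 n.
Proof.
  induction f1 as [|f1 IH]; intros [|f2] n H1 H2; try lia.
  rewrite !dec_S. pose proof (pi_le (n / 8)) as [L1 L2].
  destruct n as [|n]; [reflexivity|].
  assert (S n / 8 < S n) by (apply Nat.div_lt; lia).
  set (m := S n / 8) in *. clearbody m.
  rewrite (IH f2 (pi1 m)), (IH f2 (pi2 m)), (IH f2 m) by lia.
  reflexivity.
Qed.

Lemma program_unfold e :
  program e =
  match e mod 8 with
  | 0 => CZero
  | 1 => CSucc
  | 2 => CFst
  | 3 => CSnd
  | 4 => CComp (program (pi1 (e / 8))) (program (pi2 (e / 8)))
  | 5 => CPair (program (pi1 (e / 8))) (program (pi2 (e / 8)))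
  | 6 => CRec (program (pi1 (e / 8))) (program (pi2 (e / 8)))
  | _ => CMu (program (e / 8))
  end.
Proof.
  destruct e as [|e]; [reflexivity|].
  unfold program at 1. rewrite dec_S.
  pose proof (pi_le (S e / 8)) as [L1 L2].
  assert (S e / 8 < S e) by (apply Nat.div_lt; lia).
  set (m := S e / 8) in *. unfold program. clearbody m.
  rewrite (dec_fuel (S e) (S (pi1 m))), (dec_fuel (S e) (S (pi2 m))),
    (dec_fuel (S e) (S m)) by lia.
  reflexivity.
Qed.

Lemma divmod8_mk q r : r < 8 -> (8 * q + r) / 8 = q /\ (8 * q + r) mod 8 = r.
Proof.
  intro H. split; symmetry.
  - apply (Nat.div_unique _ _ _ r); lia.
  - apply (Nat.mod_unique _ _ q); lia.
Qed.

Lemma program_comp a b : program (8 * pair a b + 4) = CComp (program a) (program b).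
Proof.
  rewrite program_unfold. destruct (divmod8_mk (pair a b) 4) as [-> ->]; [lia|].
  now rewrite pi1_pair, pi2_pair.
Qed.

Lemma program_pair a b : program (8 * pair a b + 5) = CPair (program a) (program b).
Proof.
  rewrite program_unfold. destruct (divmod8_mk (pair a b) 5) as [-> ->]; [lia|].
  now rewrite pi1_pair, pi2_pair.
Qed.

Lemma program_surj c : exists e, program e = c.
Proof.
  induction c as [| | | |f [a Ha] h [b Hb]|f [a Ha] h [b Hb]|f [a Ha] h [b Hb]|f [a Ha]].
  - now exists 0.
  - now exists 1.
  - now exists 2.
  - now exists 3.
  - exists (8 * pair a b + 4). now rewrite program_comp, Ha, Hb.
  - exists (8 * pair a b + 5). now rewrite program_pair, Ha, Hb.
  - exists (8 * pair a b + 6). rewrite program_unfold.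
    destruct (divmod8_mk (pair a b) 6) as [-> ->]; [lia|].
    now rewrite pi1_pair, pi2_pair, Ha, Hb.
  - exists (8 * a + 7). rewrite program_unfold.
    destruct (divmod8_mk a 7) as [-> ->]; [lia|]. now rewrite Ha.
Qed.

(** * A universal machine *)

(** Stack machine: mode [0] evaluates program [e] on [v], mode [1] hands the value [v] to the top
    frame of the stack [k]. The successor in [push] keeps nonempty stacks apart from the empty stack
    [0]. *)
Definition config (m e v k : nat) : nat := pair (pair m e) (pair v k).
Definition run (e v k : nat) : nat := config 0 e v k.
Definition ret (v k : nat) : nat := config 1 0 v k.
Definition push (t a b k : nat) : nat := S (pair (pair t a) (pair b k)).

(** The nested [natcase] is a switch: with truncated subtraction, the test [r - i] is reached only
    for [r >= i], hence vanishes only at [r = i]. The default branch is the search. *)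
Definition step_run (e v k : nat) : nat :=
  let q := e / 8 in let a := pi1 q in let b := pi2 q in
  let r := e mod 8 in
  natcase r (ret 0 k)
 (natcase (r - 1) (ret (S v) k)
 (natcase (r - 2) (ret (pi1 v) k)
 (natcase (r - 3) (ret (pi2 v) k)
 (natcase (r - 4) (run b v (push 0 a 0 k))
 (natcase (r - 5) (run a v (push 1 b v k))
 (natcase (r - 6)
    (natcase (pi2 v) (run a (pi1 v) k)
      (run e (pair (pi1 v) (Nat.pred (pi2 v)))
        (push 3 b (pair (pi1 v) (Nat.pred (pi2 v))) k)))
    (run q (pair v 0) (push 4 q (pair v 0) k)))))))).

(** Frame tags: [0] pending outer function of a composition; [1] pending second component of a pair;
    [2] finished first component; [3] pending step of a recursion; otherwise a search in
    progress. *)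
Definition step_ret (v t a b k : nat) : nat :=
  natcase t (run a v k)
 (natcase (t - 1) (run a b (push 2 v 0 k))
 (natcase (t - 2) (ret (pair a v) k)
 (natcase (t - 3) (run a (pair (pi1 b) (pair (pi2 b) v)) k)
 (natcase v (ret (pi2 b) k)
   (run a (pair (pi1 b) (S (pi2 b))) (push 4 a (pair (pi1 b) (S (pi2 b))) k)))))).

(** A return to the empty stack is a fixed point, so [step] is total and halting means arriving
    there. *)
Definition step (c : nat) : nat :=
  let m := pi1 (pi1 c) in let e := pi2 (pi1 c) in
  let v := pi1 (pi2 c) in let k := pi2 (pi2 c) in
  natcase m (step_run e v k)
    (natcase k c
      (step_ret v (pi1 (pi1 (Nat.pred k))) (pi2 (pi1 (Nat.pred k)))
         (pi1 (pi2 (Nat.pred k))) (pi2 (pi2 (Nat.pred k))))).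

Lemma comp_machine : total_comp step.
Proof.
  unfold step, step_run, step_ret, run, ret, push, config.
  repeat (comp_step || apply comp_div8 || apply comp_mod8).
Qed.

Lemma step_runE e v k : step (run e v k) = step_run e v k.
Proof. unfold step, run, config. simpl_pi. reflexivity. Qed.

Lemma step_retE v t a b k : step (ret v (push t a b k)) = step_ret v t a b k.
Proof.
  unfold step, ret, config, push. simpl_pi. cbn [natcase Nat.pred].
  simpl_pi. reflexivity.
Qed.

Definition reach (c d : nat) : Prop := exists s, Nat.iter s step c = d.

Lemma reach_trans c d e : reach c d -> reach d e -> reach c e.
Proof.
  intros [s <-] [t <-]. exists (t + s). now rewrite Nat.iter_add.
Qed.

Lemma reach_step c d : reach (step c) d -> reach c d.
Proof. apply reach_trans. now exists 1. Qed.

Lemma reach_refl c : reach c c.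
Proof. now exists 0. Qed.

(* The generated [eval_ind] gives no induction hypothesis for the premises of [ev_mu]
   nested under the existential. *)
Lemma eval_nested_ind (P : code -> nat -> nat -> Prop)
  (Hz : forall x, P CZero x 0)
  (Hs : forall x, P CSucc x (S x))
  (Hf : forall a b, P CFst (pair a b) a)
  (Hn : forall a b, P CSnd (pair a b) b)
  (Hc : forall f g x y z, P g x y -> P f y z -> P (CComp f g) x z)
  (Hp : forall f g x y z, P f x y -> P g x z -> P (CPair f g) x (pair y z))
  (H0 : forall f g x y, P f x y -> P (CRec f g) (pair x 0) y)
  (HS : forall f g x n r y, P (CRec f g) (pair x n) r -> P g (pair x (pair n r)) y ->
        P (CRec f g) (pair x (S n)) y)
  (Hm : forall f x n, P f (pair x n) 0 ->
        (forall m, m < n -> exists k, k <> 0 /\ P f (pair x m) k) -> P (CMu f) x n) :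
  forall c x y, eval c x y -> P c x y.
Proof.
  fix IH 4. intros c x y H.
  destruct H as [x|x|a b|a b|f g x y z A B|f g x y z A B|f g x y A|f g x n r y A B|f x n A B].
  - apply Hz.
  - apply Hs.
  - apply Hf.
  - apply Hn.
  - apply Hc with y; apply IH; assumption.
  - apply Hp; apply IH; assumption.
  - apply H0; apply IH; assumption.
  - apply HS with r; apply IH; assumption.
  - apply Hm; [apply IH; assumption|].
    intros m L. destruct (B m L) as [k [K E]]. exists k. split; [exact K | apply IH; exact E].
Qed.

Lemma mod8_ge7 e r : e mod 8 = S (S (S (S (S (S (S r)))))) -> e mod 8 = 7.
Proof. intro. pose proof (Nat.mod_upper_bound e 8 ltac:(lia)). lia. Qed.

(** Keeping the stack general in the induction makes the hypotheses usable beneath the frames pushed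
    by the enclosing program. *)
Lemma machine_complete c x y :
  eval c x y -> forall e, program e = c -> forall k, reach (run e x k) (ret y k).
Proof.
  intro H. induction H as [x|x|a b|a b|f g x y z IHg IHf|f g x y z IHf IHg|f g x y IHf
      |f g x n r y IHr IHg|f x n IHf IHm] using eval_nested_ind;
    intros e He k; pose proof He as He'; rewrite program_unfold in He';
    remember (e mod 8) as p eqn:E; symmetry in E;
    destruct p as [|[|[|[|[|[|[|p]]]]]]]; try discriminate He';
    apply reach_step; rewrite step_runE; unfold step_run; try (apply mod8_ge7 in E);
    rewrite E; cbn -[Nat.div Nat.modulo pair run ret].
  - apply reach_refl.
  - apply reach_refl.
  - rewrite pi1_pair. apply reach_refl.
  - rewrite pi2_pair. apply reach_refl.
  - injection He' as <- <-.
    eapply reach_trans; [now apply IHg|]. apply reach_step. rewrite step_retE.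
    now apply IHf.
  - injection He' as <- <-.
    eapply reach_trans; [now apply IHf|]. apply reach_step. rewrite step_retE.
    eapply reach_trans; [now apply IHg|]. apply reach_step. rewrite step_retE.
    apply reach_refl.
  - injection He' as <- <-. rewrite pi1_pair, pi2_pair. now apply IHf.
  (* The recursive call runs the same index [e] at the predecessor. *)
  - pose proof (IHr e He) as R. injection He' as <- <-.
    rewrite pi1_pair, pi2_pair. cbn [natcase Nat.pred].
    eapply reach_trans; [apply R|]. apply reach_step. rewrite step_retE. unfold step_ret.
    cbn [natcase Nat.sub]. rewrite pi1_pair, pi2_pair. now apply IHg.
  - injection He' as <-.
    set (q := e / 8) in *.
    (* The search gets to every candidate up to [n], since all earlier tests return nonzero
       values. *)
    assert (L : forall m, m <= n ->
      reach (run q (pair x 0) (push 4 q (pair x 0) k)) (run q (pair x m) (push 4 q (pair x m) k))).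
    { induction m as [|m IH]; intro Lm; [apply reach_refl|].
      eapply reach_trans; [apply IH; lia|].
      destruct (IHm m) as [v [V Hv]]; [lia|].
      eapply reach_trans; [now apply Hv|]. apply reach_step. rewrite step_retE.
      unfold step_ret. cbn [natcase Nat.sub]. rewrite pi1_pair, pi2_pair.
      destruct v; [easy|]. apply reach_refl. }
    eapply reach_trans; [now apply (L n)|].
    eapply reach_trans; [now apply IHf|]. apply reach_step. rewrite step_retE.
    unfold step_ret. cbn [natcase Nat.sub]. rewrite pi2_pair. apply reach_refl.
Qed.

(* Zero exactly on the configurations in return mode with an empty stack. *)
Definition running (c : nat) : nat := natcase (pi1 (pi1 c)) 1 (pi2 (pi2 c)).

Lemma running_run e v k : running (run e v k) = 1.
Proof. unfold running, run, config. simpl_pi. reflexivity. Qed.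

Lemma running_ret v k : running (ret v k) = k.
Proof. unfold running, ret, config. simpl_pi. reflexivity. Qed.

Lemma step_halted c : running c = 0 -> step c = c.
Proof.
  unfold running, step. destruct (pi1 (pi1 c)); [discriminate|]. simpl. now intros ->.
Qed.

Lemma iter_halted c s : running c = 0 -> Nat.iter s step c = c.
Proof. intro H. induction s; simpl; [reflexivity|]. rewrite IHs. now apply step_halted. Qed.

Lemma iter_halted_le c s t :
  s <= t -> running (Nat.iter s step c) = 0 -> Nat.iter t step c = Nat.iter s step c.
Proof.
  intros L H. replace t with (t - s + s) by lia. rewrite Nat.iter_add. now apply iter_halted.
Qed.

(** A halting run must first return a value to the stack it started with. The remaining run is
    strictly shorter, so strong induction on the number of steps also covers what the continuation
    goes on to evaluate. *)
Lemma machine_sound s : forall e x k,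
  running (Nat.iter s step (run e x k)) = 0 ->
  exists y s', s' < s /\ eval (program e) x y /\ running (Nat.iter s' step (ret y k)) = 0.
Proof.
  induction s as [s IH] using (well_founded_induction lt_wf). intros e x k H.
  destruct s as [|s]; [simpl in H; rewrite running_run in H; discriminate|].
  rewrite Nat.iter_succ_r, step_runE in H. unfold step_run in H.
  (* A return to a nonempty stack has not halted, so at least one more step is made. *)
  assert (RET : forall t y t' a b k', t < S s ->
    running (Nat.iter t step (ret y (push t' a b k'))) = 0 ->
    exists t0, t0 < t /\ running (Nat.iter t0 step (step_ret y t' a b k')) = 0).
  { intros t y t' a b k' L R. destruct t as [|t].
    - simpl in R. rewrite running_ret in R. discriminate.
    - rewrite Nat.iter_succ_r, step_retE in R. exists t. split; [lia | exact R]. }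
  pose proof (program_unfold e) as P. rewrite P.
  remember (e mod 8) as r eqn:E; symmetry in E.
  destruct r as [|[|[|[|[|[|[|r]]]]]]]; cbn -[Nat.div Nat.modulo pair run ret push Nat.iter] in H.
  - exists 0, s. repeat split; [lia | constructor | exact H].
  - exists (S x), s. repeat split; [lia | constructor | exact H].
  - exists (pi1 x), s. repeat split; [lia | apply eval_fst | exact H].
  - exists (pi2 x), s. repeat split; [lia | apply eval_snd | exact H].
  - apply IH in H as (y & s1 & L1 & E1 & H1); [|lia].
    apply RET in H1 as (s2 & L2 & H2); [|lia]. unfold step_ret in H2; cbn [natcase] in H2.
    apply IH in H2 as (z & s3 & L3 & E3 & H3); [|lia].
    exists z, s3. repeat split; [lia | exact (ev_comp _ _ _ _ _ E1 E3) | exact H3].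
  - apply IH in H as (y & s1 & L1 & E1 & H1); [|lia].
    apply RET in H1 as (s2 & L2 & H2); [|lia]. unfold step_ret in H2; cbn [natcase Nat.sub] in H2.
    apply IH in H2 as (z & s3 & L3 & E3 & H3); [|lia].
    apply RET in H3 as (s4 & L4 & H4); [|lia]. unfold step_ret in H4; cbn [natcase Nat.sub] in H4.
    exists (pair y z), s4. repeat split; [lia | now constructor | exact H4].
  - rewrite <- (pair_pi x). destruct (pi2 x) as [|n]; cbn [natcase Nat.pred] in H.
    + apply IH in H as (y & s1 & L1 & E1 & H1); [|lia].
      exists y, s1. repeat split; [lia | now constructor | exact H1].
    + apply IH in H as (y & s1 & L1 & E1 & H1); [|lia]. rewrite P in E1.
      apply RET in H1 as (s2 & L2 & H2); [|lia].
      unfold step_ret in H2; cbn [natcase Nat.sub] in H2. rewrite pi1_pair, pi2_pair in H2.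
      apply IH in H2 as (z & s3 & L3 & E3 & H3); [|lia].
      exists z, s3. repeat split; [lia | exact (ev_recS _ _ _ _ _ _ E1 E3) | exact H3].
  - set (q := e / 8) in *. clearbody q.
    (* The outer induction evaluates a single test; an inner induction on the remaining steps
       follows the search, with the failure of all earlier candidates as invariant. *)
    assert (M : forall t, t <= s -> forall n,
      (forall m, m < n -> exists v, v <> 0 /\ eval (program q) (pair x m) v) ->
      running (Nat.iter t step (run q (pair x n) (push 4 q (pair x n) k))) = 0 ->
      exists y s', s' < S s /\ eval (CMu (program q)) x y /\
        running (Nat.iter s' step (ret y k)) = 0).
    { induction t as [t IHt] using (well_founded_induction lt_wf). intros Lt n N R.
      apply IH in R as (v & s1 & L1 & E1 & H1); [|lia].
      apply RET in H1 as (s2 & L2 & H2); [|lia].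
      unfold step_ret in H2; cbn [natcase Nat.sub] in H2. rewrite pi1_pair, pi2_pair in H2.
      destruct v as [|v]; cbn [natcase] in H2.
      - exists n, s2. repeat split; [lia | now constructor | exact H2].
      - apply (IHt s2) with (n := S n) in H2; [exact H2 | lia | lia |].
        intros m Lm. destruct (Nat.eq_dec m n) as [->|]; [|apply N; lia].
        now exists (S v). }
    apply (M s) with (n := 0); [lia | lia | exact H].
Qed.

(** A counterpart of Kleene's T predicate. Zero stands for truth here and below, so that sums act as
    conjunctions. *)
Definition halt_test (e x s : nat) : nat := running (Nat.iter s step (run e x 0)).

Lemma comp_halt_test e x s :
  total_comp e -> total_comp x -> total_comp s ->
  total_comp (fun z => halt_test (e z) (x z) (s z)).
Proof.
  intros He Hx Hs. unfold halt_test, running.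
  assert (total_comp (fun z => Nat.iter (s z) step (run (e z) (x z) 0))).
  { apply comp_iter; [apply comp_machine | exact Hs | unfold run, config; comp; assumption]. }
  comp; assumption.
Qed.

Lemma halt_testP e x : W e x <-> exists s, halt_test e x s = 0.
Proof.
  split.
  - intros [y Hy]. destruct (machine_complete _ _ _ Hy e eq_refl 0) as [s Hs].
    exists s. unfold halt_test. now rewrite Hs, running_ret.
  - intros [s Hs]. apply machine_sound in Hs as (y & _ & _ & Hy & _). now exists y.
Qed.

Lemma halt_test_le e x s t : s <= t -> halt_test e x s = 0 -> halt_test e x t = 0.
Proof. unfold halt_test. intros L H. now rewrite (iter_halted_le _ s t). Qed.

(** Determinism is inherited from the machine: both runs start alike, and the one that halts first
    no longer moves. *)
Lemma eval_functional c x y z : eval c x y -> eval c x z -> y = z.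
Proof.
  intros Hy Hz. destruct (program_surj c) as [e He].
  destruct (machine_complete _ _ _ Hy e He 0) as [s Hs].
  destruct (machine_complete _ _ _ Hz e He 0) as [t Ht].
  assert (R : ret y 0 = ret z 0).
  { destruct (Nat.le_ge_cases s t) as [L|L].
    - rewrite <- Hs, <- Ht. symmetry. apply iter_halted_le; [exact L|].
      now rewrite Hs, running_ret.
    - rewrite <- Hs, <- Ht. apply iter_halted_le; [exact L|]. now rewrite Ht, running_ret. }
  apply (f_equal (fun c => pi1 (pi2 c))) in R. unfold ret, config in R.
  now rewrite !pi2_pair, !pi1_pair in R.
Qed.

(** * The recursion theorem for c.e. sets *)

(** The set is the domain of an unbounded search for [t]; totality of [f] makes every test before
    the first zero converge. *)
Lemma sigma1_ce f : total_comp f ->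
  exists e, forall w, W e w <-> exists t, f (pair w t) = 0.
Proof.
  intros [c H]. destruct (program_surj (CMu c)) as [e He]. exists e. intro w.
  unfold W, halts. rewrite He. split.
  - intros [y Hy]. exists y. inversion Hy as [| | | | | | | |? ? ? E _]; subst.
    exact (eval_functional _ _ _ _ (H _) E).
  - intros [t Ht]. induction t as [t IH] using (well_founded_induction lt_wf).
    destruct (classic (exists m, m < t /\ f (pair w m) = 0)) as [[m [L E]]|N].
    + exact (IH m L E).
    + exists t. constructor; [rewrite <- Ht; apply H|].
      intros m L. exists (f (pair w m)). split; [|apply H]. intro E. apply N. now exists m.
Qed.

Definition const_index (n : nat) : nat := Nat.iter n (fun r => 8 * pair 1 r + 4) 0.

Lemma program_const n : program (const_index n) = const_code n.
Proof.
  induction n as [|n IH]; [reflexivity|].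
  change (const_index (S n)) with (8 * pair 1 (const_index n) + 4).
  now rewrite program_comp, IH.
Qed.

(* [8 * pair 2 3 + 5] is an index of the identity [CPair CFst CSnd]. *)
Definition self_index (i : nat) : nat :=
  8 * pair i (8 * pair (const_index i) (8 * pair 2 3 + 5) + 5) + 4.

(** The diagonal case of the s-m-n theorem: program [i] is preceded by a program that supplies the
    constant [i] as first input. *)
Lemma W_self_index i w : W (self_index i) w <-> W i (pair i w).
Proof.
  unfold W, halts, self_index. rewrite program_comp, !program_pair, program_const.
  assert (K : eval (CPair (const_code i) (CPair (program 2) (program 3))) w (pair i w)).
  { constructor; [apply eval_const|]. rewrite <- (pair_pi w) at 2.
    constructor; [apply eval_fst | apply eval_snd]. }
  split; intros [y Hy].
  - exists y. inversion Hy as [| | | |? ? ? v ? A B| | | |]; subst.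
    now rewrite <- (eval_functional _ _ _ _ A K).
  - exists y. econstructor; [exact K | exact Hy].
Qed.

Lemma comp_mul8 f : total_comp f -> total_comp (fun x => 8 * f x).
Proof. intro Hf. unfold Nat.mul. comp; exact Hf. Qed.

Lemma comp_self_index : total_comp self_index.
Proof.
  assert (K : total_comp const_index).
  { unfold const_index. apply (comp_iter _ (fun n => n) (fun _ => 0)); [|comp..].
    apply comp_add; [apply comp_mul8, (comp_pair (fun _ => 1) (fun r => r))|]; comp. }
  unfold self_index. apply comp_add; [apply comp_mul8|comp]. apply comp_pair; [comp|].
  apply comp_add; [apply comp_mul8|comp]. apply comp_pair; [exact K | apply comp_const].
Qed.

(** Kleene's diagonal argument: let [e] enumerate [pair i w] when [f (self_index i) w] has a zero,
    and take [i = e]. *)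
Lemma ce_recursion (f : nat -> nat -> nat -> nat) :
  total_comp (fun z => f (pi1 z) (pi1 (pi2 z)) (pi2 (pi2 z))) ->
  exists j, forall w, W j w <-> exists t, f j w t = 0.
Proof.
  intro Hf.
  pose (h := fun z => pair (self_index (pi1 (pi1 z))) (pair (pi2 (pi1 z)) (pi2 z))).
  assert (Hh : total_comp h).
  { unfold h. comp. apply comp_comp; [apply comp_self_index | comp]. }
  destruct (sigma1_ce _ (comp_comp _ _ Hf Hh)) as [e He].
  exists (self_index e). intro w. rewrite W_self_index, He. unfold h.
  apply Morphisms_Prop.ex_iff_morphism. intro t.
  simpl_pi. reflexivity.
Qed.

(** * Presentations of families of initial segments *)

(** With [sum_eq0], this makes bounded universal quantification computable. *)
Lemma comp_sum f p q : total_comp (fun z => f (pi1 z) (pi2 z)) -> total_comp p -> total_comp q ->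
  total_comp (fun x => nat_rect (fun _ => nat) 0 (fun z r => f (p x) z + r) (q x)).
Proof.
  intros Hf Hp Hq.
  eapply comp_ext;
    [|apply (comp_rec (fun _ => 0)
         (fun u => f (pi1 u) (pi1 (pi2 u)) + pi2 (pi2 u)) p q); [comp| |exact Hp|exact Hq]].
  - intro x; simpl. induction (q x) as [|n IH]; simpl; [reflexivity|].
    rewrite IH. simpl_pi. reflexivity.
  - apply comp_add; [|comp].
    eapply comp_ext; [|apply (comp_comp _ (fun u => pair (pi1 u) (pi1 (pi2 u))) Hf); comp].
    intro u; simpl. simpl_pi. reflexivity.
Qed.

Lemma sum_eq0 (f : nat -> nat) n :
  nat_rect (fun _ => nat) 0 (fun z r => f z + r) n = 0 <-> forall z, z < n -> f z = 0.
Proof.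
  induction n as [|n IH]; simpl.
  - split; [intros; lia | reflexivity].
  - split.
    + intros H z Hz. destruct (Nat.eq_dec z n) as [->|]; [lia|]. apply IH; lia.
    + intro H. rewrite (H n) by lia. apply IH. intros z Hz. apply H. lia.
Qed.

Lemma decidable_ce f : total_comp f -> exists e, forall w, W e w <-> f w = 0.
Proof.
  intro Hf. destruct (sigma1_ce _ (comp_comp _ _ Hf (comp_pi1 _ comp_id))) as [e He].
  exists e. intro w. rewrite He. split.
  - intros [t Ht]. now rewrite pi1_pair in Ht.
  - intro H. exists 0. now rewrite pi1_pair.
Qed.

Definition segment (k x : nat) : Prop := x < k.

(** The least missing element, if there is one, is the length of the segment. *)
Lemma initial_segment_or_full (A : nat -> Prop) :
  (forall x y, x <= y -> A y -> A x) ->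
  (exists k, set_eq A (segment k)) \/ (forall x, A x).
Proof.
  intro D. destruct (classic (forall x, A x)) as [F|F]; [now right|left].
  apply not_all_ex_not in F as [n Hn].
  induction n as [n IH] using (well_founded_induction lt_wf).
  destruct (classic (exists m, m < n /\ ~ A m)) as [[m [L M]]|N]; [exact (IH m L M)|].
  exists n. intro x. unfold segment. split.
  - intro Ax. destruct (Nat.lt_ge_cases x n) as [|G]; [assumption|]. now apply (D n x G) in Ax.
  - intro L. apply NNPP. intro H. apply N. now exists x.
Qed.

(** * Agreement of c.e. columns from a point on, and its approximations *)

Definition agree_from (A B : nat -> Prop) (k : nat) : Prop :=
  forall y, k <= y -> (A y <-> B y).

(** Brings out the Sigma_3 form of almost equality: for c.e. sets, the condition after the
    quantifier over [k] is Pi_2. *)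
Lemma finite_symdiffP A B : finite_set (symdiff A B) <-> exists k, agree_from A B k.
Proof.
  split.
  - intros [l Hl]. exists (S (list_max l)). intros y Hy.
    assert (N : ~ In y l).
    { intro I. pose proof (proj1 (list_max_le l _) (le_n _)) as M.
      rewrite Forall_forall in M. apply M in I. lia. }
    unfold symdiff in Hl.
    split; intro H; apply NNPP; intro K; apply N, Hl; tauto.
  - intros [k Hk]. exists (seq 0 k). intros y Hy. apply in_seq.
    destruct (Nat.lt_ge_cases y k) as [|G]; [lia|].
    pose proof (Hk y G). unfold symdiff in Hy. tauto.
Qed.

Lemma agree_from_trans A B C k l :
  agree_from A B k -> agree_from B C l -> agree_from A C (k + l).
Proof. intros H K y L. rewrite (H y), (K y) by lia. reflexivity. Qed.

(* [0] iff [p = 0] implies [q = 0]. *)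
Definition implb0 (p q : nat) : nat := natcase p q 0.

(** Two stages are kept apart because the premises are read at a given stage [s], whereas the stage
    [t] of the conclusions is to be quantified existentially. Points are given by their offset [z]
    from [k]. *)
Definition disagreement (u v n k s t z : nat) : nat :=
  implb0 (halt_test u (pair (k + z) n) s) (halt_test v (pair (k + z) n) t)
  + implb0 (halt_test v (pair (k + z) n) s) (halt_test u (pair (k + z) n) t).

(* Agreement of two c.e. sets from [k] on is Pi_2; its finite approximations, "every
   [y] in [[k, k + x)] enumerated into one set by stage [x] is eventually in the other",
   are Sigma_1 and decreasing in [x]. *)
Lemma agree_from_approx u v n k x :
  (exists t, forall z, z < x -> disagreement u v n k x t z = 0) <->
  (forall z, z < x ->
     (halt_test u (pair (k + z) n) x = 0 -> W v (pair (k + z) n)) /\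
     (halt_test v (pair (k + z) n) x = 0 -> W u (pair (k + z) n))).
Proof.
  unfold disagreement, implb0. split.
  - intros [t H] z L. specialize (H z L). split; intro E; rewrite E in H; simpl in H;
      apply halt_testP; exists t; lia.
  - intro H.
    (* One stage [t] must serve all points at once. It is built by adding points one by one and
       summing stages, as halting persists at later stages. *)
    enough (G : forall m, m <= x -> exists t, forall z, z < m ->
        natcase (halt_test u (pair (k + z) n) x) (halt_test v (pair (k + z) n) t) 0
        + natcase (halt_test v (pair (k + z) n) x) (halt_test u (pair (k + z) n) t) 0 = 0)
      by exact (G x (le_n _)).
    intros m Lm. induction m as [|m IH]; [exists 0; intros; lia|].
    destruct IH as [t Ht]; [lia|].
    assert (B : forall p q, (halt_test p (pair (k + m) n) x = 0 -> W q (pair (k + m) n)) ->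
      exists t', forall t'', t' <= t'' ->
        natcase (halt_test p (pair (k + m) n) x) (halt_test q (pair (k + m) n) t'') 0 = 0).
    { intros p q I. destruct (halt_test p (pair (k + m) n) x); simpl; [|now exists 0].
      destruct (proj1 (halt_testP _ _) (I eq_refl)) as [t' Ht']. exists t'.
      intros t'' L. now apply halt_test_le with t'. }
    destruct (H m ltac:(lia)) as [H1 H2].
    destruct (B u v H1) as [t1 T1], (B v u H2) as [t2 T2].
    exists (t + t1 + t2). intros z L. destruct (Nat.eq_dec z m) as [->|].
    + rewrite T1, T2 by lia. reflexivity.
    + specialize (Ht z ltac:(lia)).
      assert (M : forall p q,
        natcase (halt_test p (pair (k + z) n) x) (halt_test q (pair (k + z) n) t) 0 = 0 ->
        natcase (halt_test p (pair (k + z) n) x)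
          (halt_test q (pair (k + z) n) (t + t1 + t2)) 0 = 0).
      { intros p q. destruct (halt_test p (pair (k + z) n) x); simpl; [|easy].
        apply halt_test_le. lia. }
      rewrite (M u v), (M v u) by lia. reflexivity.
Qed.

Lemma agree_from_limit u v n k :
  agree_from (column (W u) n) (column (W v) n) k <->
  forall x, exists t, forall z, z < x -> disagreement u v n k x t z = 0.
Proof.
  split.
  - intros H x. apply agree_from_approx. intros z _.
    specialize (H (k + z) ltac:(lia)). unfold column in H.
    split; intro E; apply H, halt_testP; now exists x.
  - intros H y L. unfold column.
    (* The number [x] bounds both the enumeration stage and the offset of [y], so it has to exceed
       each of them. *)
    assert (K : forall s, exists x, s <= x /\ y - k < x)
      by (intro s; exists (s + S (y - k)); lia).
    replace y with (k + (y - k)) by lia.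
    split; intro E; apply halt_testP in E as [s Hs]; destruct (K s) as (x & Ls & Lx);
      apply (halt_test_le _ _ _ x Ls) in Hs;
      now apply (proj1 (agree_from_approx u v n k x) (H x)).
Qed.

(** A larger bound admits more points and more enumerated elements, hence demands more. This makes
    the test columns below closed downwards. *)
Lemma approx_decreasing u v n k x x' : x <= x' ->
  (exists t, forall z, z < x' -> disagreement u v n k x' t z = 0) ->
  exists t, forall z, z < x -> disagreement u v n k x t z = 0.
Proof.
  rewrite !agree_from_approx. intros L H z Lz.
  destruct (H z ltac:(lia)) as [H1 H2].
  split; intro E; [apply H1 | apply H2]; now apply halt_test_le with x.
Qed.

(** The recursion theorem lets the columns of [j] mention [g j]. In a test column the element [x] is
    itself the bound of the approximation, so the column is omega exactly when agreement from [k] on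
    holds. Every number codes a column, and the spare [b] merely repeats test columns. *)
Lemma agreement_index g n u : total_comp g -> exists j,
  (forall k, set_eq (column (W j) (pair k 0)) (segment k)) /\
  (forall k b, set_eq (column (W j) (pair k (S b)))
     (fun x => exists t, forall z, z < x -> disagreement u (g j) n k x t z = 0)).
Proof.
  intro Hg.
  pose (dis := fun d z =>
    disagreement u (pi1 d) n (pi1 (pi2 d)) (pi1 (pi2 (pi2 d))) (pi2 (pi2 (pi2 d))) z).
  assert (HS : total_comp (fun z => dis (pi1 z) (pi2 z))).
  { unfold dis, disagreement, implb0. repeat (apply comp_halt_test || comp_step). }
  (* For the segment columns, [S x - k] vanishes exactly when [x < k]. *)
  pose (f := fun j w t =>
    let x := pi1 w in let k := pi1 (pi2 w) in
    natcase (pi2 (pi2 w)) (S x - k)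
      (nat_rect (fun _ => nat) 0
        (fun z r => dis (pair (g j) (pair k (pair x t))) z + r) x)).
  assert (Hf : total_comp (fun z => f (pi1 z) (pi1 (pi2 z)) (pi2 (pi2 z)))).
  { unfold f. apply comp_case; [comp..|]. apply comp_sum; [exact HS| |comp].
    comp. apply comp_comp; [exact Hg | comp]. }
  destruct (ce_recursion f Hf) as [j Hj]. exists j.
  split; intros k; [|intro b]; intro x; unfold column, segment; rewrite Hj; unfold f; simpl_pi;
    cbn [natcase].
  - split; [intros [_ H]; lia | intro; exists 0; lia].
  - apply Morphisms_Prop.ex_iff_morphism. intro t. rewrite sum_eq0.
    unfold dis. simpl_pi. reflexivity.
Qed.

Theorem theorem2p6 : ~ creducible Ece_set Ece_3.
Proof.
  intros [g [[eg Hg] Hred]].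
  assert (Cg : total_comp g) by (now exists (program eg)).
  destruct (decidable_ce (fun w => S (pi1 w) - pi2 w)) as [a Ha]; [comp|].
  (* Column [0] is reserved for omega, which shifts the segments by one. *)
  destruct (decidable_ce (fun w => natcase (pi2 w) 0 (S (pi1 w) - Nat.pred (pi2 w)))) as [b Hb];
    [comp|].
  assert (Ca : forall k, set_eq (column (W a) k) (segment k)).
  { intros k x. unfold column, segment. rewrite Ha. simpl_pi. lia. }
  assert (Cb0 : forall x, column (W b) 0 x).
  { intro x. unfold column. rewrite Hb. now simpl_pi. }
  assert (CbS : forall k, set_eq (column (W b) (S k)) (segment k)).
  { intros k x. unfold column, segment. rewrite Hb. simpl_pi. cbn [natcase Nat.pred]. lia. }
  assert (Eab : Ece_3 (g a) (g b)).
  { intro n. destruct (agreement_index g n (g a) Cg) as [j [J0 J1]].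
    assert (Jset : forall c,
      (exists k, set_eq (column (W j) c) (segment k)) \/
      ((forall x, column (W j) c x) /\
       exists k, agree_from (column (W (g a)) n) (column (W (g j)) n) k)).
    { intro c. rewrite <- (pair_pi c).
      destruct (pi2 c) as [|c2]; [left; exists (pi1 c); apply J0|].
      destruct (initial_segment_or_full (column (W j) (pair (pi1 c) (S c2)))) as [F|F].
      - intros x y L. rewrite !(J1 _ _ _). now apply approx_decreasing.
      - now left.
      - right. split; [exact F|]. exists (pi1 c). apply agree_from_limit.
        intro x. now apply (J1 _ c2). }
    (* Without agreement no column of [j] is omega, so [j] presents the family of [a]; the reduction
       then yields the very agreement denied. *)
    assert (Aj : exists k, agree_from (column (W (g a)) n) (column (W (g j)) n) k).
    { apply NNPP. intro N. apply N. apply finite_symdiffP, Hred. split.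
      - intro k. exists (pair k 0). intro x. now rewrite (Ca k x), (J0 k x).
      - intro c. destruct (Jset c) as [[k Hk]|[_ A]]; [|contradiction].
        exists k. intro x. now rewrite (Ca k x), (Hk x). }
    destruct Aj as [k Hk].
    assert (Ejb : Ece_3 (g j) (g b)).
    { apply Hred. split.
      - intro c. destruct (Jset c) as [[l Hl]|[F _]].
        + exists (S l). intro x. now rewrite (CbS l x), (Hl x).
        + exists 0. intro x. split; intros _; [apply Cb0 | apply F].
      - intros [|l].
        (* A test column for the [k] at which agreement holds, hence omega. *)
        + exists (pair k 1). intro x. split; intros _; [apply Cb0|].
          apply (J1 k 0). revert x. now apply agree_from_limit.
        + exists (pair l 0). intro x. now rewrite (CbS l x), (J0 l x). }
    apply finite_symdiffP. destruct (proj1 (finite_symdiffP _ _) (Ejb n)) as [l Hl].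
    exists (k + l). exact (agree_from_trans _ _ _ _ _ Hk Hl). }
  apply Hred in Eab as [_ Eab]. destruct (Eab 0) as [k Hk].
  (* Omega would be the segment of length [k], which misses [k]. *)
  assert (F : segment k k) by (apply (Ca k k), (Hk k), Cb0).
  unfold segment in F. lia.
Qed.
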